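(* Let $G$ be a finite connected graph of order $n$, and let $\bar G$ be its complement. Then $$L_{2}(G)+L_{2}(\bar G)\leq n+2,$$ and this bound is sharp.
   Context: Graphs are simple and undirected. The order of $G$ is $|V(G)|$. The complement $\bar G$ has the same vertex set as $G$, and two distinct vertices $u,v$ are adjacent in $\bar G$ if and only if they are not adjacent in $G$. For a vertex $u$ of a graph $H$ (connected or not), $N_H[u]$ denotes its closed neighborhood ($u$ together with all its neighbors in $H$). A subset $B\subseteq V(H)$ is a $2$-limited packing in $H$ if $|N_H[u]\cap B|\leq 2$ for every $u\in V(H)$, and $L_{2}(H)$ is the maximum cardinality of a $2$-limited packing in $H$. ''Sharp'' means that equality is attained. *)

(* Defs.v *)
From mathcomp Require Import all_boot.

Set Implicit Arguments.
Unset Strict Implicit.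
Unset Printing Implicit Defensive.

Record sgraph := SGraph {
  svertex :> finType;
  sedge : rel svertex;
  sedge_sym : symmetric sedge;
  sedge_irrefl : irreflexive sedge }.

Section Graph.

Variable G : sgraph.

(* The null graph does not count as connected. *)
Definition connected_graph : Prop :=
  0 < #|G| /\ forall u v : G, connect (@sedge G) u v.

Definition compl_edge : rel G := fun u v => (u != v) && ~~ sedge u v.

Lemma compl_edge_sym : symmetric compl_edge.
Proof. by move=> u v; rewrite /compl_edge eq_sym sedge_sym. Qed.

Lemma compl_edge_irrefl : irreflexive compl_edge.
Proof. by move=> u; rewrite /compl_edge eqxx. Qed.

Definition compl_graph : sgraph := SGraph compl_edge_sym compl_edge_irrefl.

Definition closed_nbhd (u : G) : {set G} := [set v | (v == u) || sedge u v].

Definition two_limited_packing (B : {set G}) : bool :=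
  [forall u : G, #|closed_nbhd u :&: B| <= 2].

Definition L2 : nat := \max_(B : {set G} | two_limited_packing B) #|B|.

End Graph.

(* Main.v *)
Require Import Defs.
From mathcomp Require Import all_boot.

(** If [B] and [B'] are 2-limited packings in a graph and in its complement, no
    three vertices lie in [B :&: B']: among three vertices, one is adjacent to both
    others or to neither of them, so its closed neighbourhood, in the graph or in
    the complement, contains all three. Hence #|B| + #|B'| =
    #|B :|: B'| + #|B :&: B'| <= n + 2. The complete graph on two vertices
    attains the bound. *)

Lemma two_limited_packing_adj (G : sgraph) (B : {set G}) (x y z : G) :
  two_limited_packing B -> x \in B -> y \in B -> z \in B ->
  x != y -> y != z -> z != x -> sedge x y -> sedge x z -> False.
Proof.
move=> /forallP /(_ x) + xB yB zB xy yz zx exy exz.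
rewrite leqNgt => /negP; apply; apply/card_gt2P; exists x, y, z.
by rewrite !inE eqxx exy exz !orbT xB yB zB.
Qed.

Lemma card_packing_setI (G : sgraph) (B B' : {set G}) :
  two_limited_packing B ->
  @two_limited_packing (compl_graph G) B' -> #|B :&: B'| <= 2.
Proof.
move=> pB pB'; rewrite leqNgt; apply/negP => /card_gt2P [x [y [z [[]]]]].
move=> /setIP[xB xB'] /setIP[yB yB'] /setIP[zB zB'] [xy yz zx].
have yx : y != x by rewrite eq_sym.
have zy : z != y by rewrite eq_sym.
have xz : x != z by rewrite eq_sym.
(* If [u] had the same status towards [v] and [w], its closed neighbourhood in [G] or in the
   complement would contain all three. *)
have no_common (u v w : G) : u \in B -> v \in B -> w \in B ->
    u \in B' -> v \in B' -> w \in B' -> u != v -> v != w -> w != u ->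
    sedge u v != sedge u w.
  move=> uB vB wB uB' vB' wB' uv vw wu; apply/eqP => e.
  case: (boolP (sedge u v)) => euv.
    by apply: (two_limited_packing_adj _ _ _ _ _ pB uB vB wB) => //; rewrite -e.
  apply: (two_limited_packing_adj _ _ _ _ _ pB' uB' vB' wB') => //=.
    by rewrite /compl_edge uv.
  by rewrite /compl_edge eq_sym wu -e.
(* Up to symmetry of [sedge], the three edge statuses are pairwise distinct, impossible for
   booleans. *)
have := no_common x y z xB yB zB xB' yB' zB' xy yz zx.
have := no_common y z x yB zB xB yB' zB' xB' yz zx xy.
have := no_common z x y zB xB yB zB' xB' yB' zx xy yz.
rewrite (sedge_sym y x) (sedge_sym z x) (sedge_sym z y).
by case: (sedge x y); case: (sedge x z); case: (sedge y z).
Qed.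

(** The empty set is a packing, so the maximum ranges over a nonempty family. *)
Lemma L2_attained (G : sgraph) :
  exists2 B : {set G}, two_limited_packing B & L2 G = #|B|.
Proof.
have [|B pB L2B] := @eq_bigmax_cond _ (@two_limited_packing G) (fun B => #|B|).
  apply/card_gt0P; exists set0; apply/forallP => u.
  by rewrite setI0 cards0.
by exists B; last exact: L2B.
Qed.

(** With at most two vertices, the whole vertex set is a packing. *)
Lemma L2_order_le2 (G : sgraph) : #|G| <= 2 -> L2 G = #|G|.
Proof.
move=> G2; apply/eqP; rewrite eqn_leq; apply/andP; split.
  by apply/bigmax_leqP => B _; exact: max_card.
rewrite -cardsT /L2; apply: (@leq_bigmax_cond _ _ (fun B : {set G} => #|B|)).
by apply/forallP => u; apply: leq_trans (max_card _) G2.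
Qed.

Lemma neq_sym (T : eqType) : symmetric (fun x y : T => x != y).
Proof. by move=> x y; rewrite eq_sym. Qed.

Lemma neq_irrefl (T : eqType) : irreflexive (fun x y : T => x != y).
Proof. by move=> x; rewrite eqxx. Qed.

Definition complete_graph (T : finType) : sgraph :=
  SGraph (neq_sym T) (neq_irrefl T).

Theorem theorem2p3 :
  (forall G : sgraph, connected_graph G ->
     L2 G + L2 (compl_graph G) <= #|G| + 2) /\
  (exists G : sgraph, connected_graph G /\
     L2 G + L2 (compl_graph G) = #|G| + 2).
Proof.
split=> [G _|].
  have [B pB ->] := L2_attained G.
  have [B' pB' ->] := L2_attained (compl_graph G).
  rewrite -(cardsUI B B').
  exact: leq_add (max_card _) (card_packing_setI _ _ _ pB pB').
(* This graph and its edgeless complement both have order 2, so both sides equal 4. *)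
exists (complete_graph bool); split; last by rewrite !L2_order_le2 /= ?card_bool.
split=> [|u v]; first by rewrite card_bool.
have [->|uv] := eqVneq u v; first exact: connect0.
exact: connect1.
Qed.
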